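(* Let $\mathcal{A}$ be a subspace arrangement embedded in $\mathcal{B}_n$. Then \[ \frac{\overline{h}(\mathcal{A},\mathcal{B}_n;x)}{(1-x)^{d(\mathcal{A})+1}}=\sum_{m\geq 0}T(\mathcal{A};2m+1)\,x^m. \]
   Context: $\mathcal{B}_n$ is the arrangement in $\mathbb{R}^n$ of the $n^2$ hyperplanes $x_i=\tau x_j$ ($1\le i<j\le n$, $\tau\in\{-1,1\}$) and $x_i=0$ ($i\in[n]$). Its intersection lattice $L_{\mathcal{B}_n}$ consists of all intersections of subfamilies of these hyperplanes, ordered by reverse inclusion. A subspace arrangement $\mathcal{A}$ (finite set of linear subspaces, none containing another) is embedded in $\mathcal{B}_n$ if it is an antichain in $L_{\mathcal{B}_n}$. $\Delta_{\mathcal{B}_n}$ is the simplicial decomposition of $S^{n-1}$ whose cells are the sets of points with a common sign vector with respect to the hyperplanes of $\mathcal{B}_n$, and $\Delta_{\mathcal{A},\mathcal{B}_n}$ is its subcomplex formed by $(\bigcup\mathcal{A})\cap S^{n-1}$. $d(\mathcal{A})=\max_{A\in\mathcal{A}}\dim A$, so $\Delta_{\mathcal{A},\mathcal{B}_n}$ has dimension $d(\mathcal{A})-1$. For a simplicial complex $\Delta$ of dimension $d-1$, $h(\Delta;x)=\sum_{i=0}^d f_{i-1}(x-1)^{d-i}$ ($f_i$ = number of $i$-faces, $f_{-1}=1$ if nonempty), $\overline{h}(\Delta;x)=x^dh(\Delta;1/x)$, and $\overline{h}(\mathcal{A},\mathcal{B}_n;x)=\overline{h}(\Delta_{\mathcal{A},\mathcal{B}_n};x)$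 (taken to be $0$ if $\mathcal{A}=\emptyset$). The characteristic polynomial is $\chi(\mathcal{A};x)=\sum_{Y\in L_\mathcal{A}}\mu(\mathbb{R}^n,Y)x^{\dim Y}$, where $L_\mathcal{A}$ is the lattice of intersections of subfamilies of $\mathcal{A}$ (least element $\mathbb{R}^n$) ordered by reverse inclusion and $\mu$ its Möbius function. The tail is $T(\mathcal{A};x)=x^{n}-\chi(\mathcal{A};x)$.
   Formalization: The subspaces in the arrangement are assumed proper (the whole space R^n is not a member); this excludes only the arrangement {R^n}, for which the tail T is 0 while the left-hand side is nonzero. *)

(* Defs.v *)
From HB Require Import structures.
From mathcomp Require Import all_boot all_order all_algebra.
From mathcomp Require Import finmap boolp classical_sets reals.

Set Implicit Arguments.
Unset Strict Implicit.
Unset Printing Implicit Defensive.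

Import Order.TTheory GRing.Theory Num.Theory.

Local Open Scope ring_scope.

(** * Formal power series, as coefficient sequences *)

Section FormalPowerSeries.
Variable K : unitRingType.
Implicit Types (f g : nat -> K) (p : {poly K}).

Definition fps_of_poly p : nat -> K := fun m => p`_m.

Definition fps_mul f g : nat -> K :=
  fun m => \sum_(i < m.+1) f i * g (m - i)%N.

(* The coefficients of order <= m of 1/f, where f has an invertible constant
   coefficient: g_0 = 1/f_0, g_m = - (1/f_0) (f_m g_0 + ... + f_1 g_(m-1)). *)
Fixpoint fps_inv_seq f (m : nat) : seq K :=
  if m is m'.+1 then
    let s := fps_inv_seq f m' in
    rcons s (- ((f 0%N)^-1 * \sum_(i < m) f (m - i)%N * s`_i))
  else [:: (f 0%N)^-1].

Definition fps_inv f : nat -> K := fun m => (fps_inv_seq f m)`_m.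

Definition fps_div f g : nat -> K := fps_mul f (fps_inv g).

Lemma size_fps_inv_seq f m : size (fps_inv_seq f m) = m.+1.
Proof. by elim: m => //= m IHm; rewrite size_rcons IHm. Qed.

Lemma nth_fps_inv_seq f m i : (i <= m)%N -> (fps_inv_seq f m)`_i = fps_inv f i.
Proof.
elim: m => [|m IHm]; first by rewrite leqn0 => /eqP ->.
rewrite leq_eqVlt => /predU1P[-> //|]; rewrite ltnS => le_im /=.
by rewrite nth_rcons size_fps_inv_seq ltnS le_im IHm.
Qed.

Lemma fps_mulfV f : f 0%N \is a GRing.unit ->
  forall m, fps_mul f (fps_inv f) m = (m == 0%N)%:R.
Proof.
move=> f0U [|m]; first by rewrite /fps_mul big_ord1 /= divrr.
rewrite /fps_mul (reindex_inj rev_ord_inj) /= big_ord_recr /= subnn subn0.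
rewrite [fps_inv f m.+1]/fps_inv /= nth_rcons size_fps_inv_seq ltnn eqxx.
rewrite mulrN mulVKr //; apply/eqP; rewrite subr_eq0; apply/eqP.
apply: eq_bigr => i _; have lei : (i <= m)%N by rewrite -ltnS.
rewrite nth_fps_inv_seq // !subSS subKn //.
by rewrite leqW.
Qed.

End FormalPowerSeries.

(** * Möbius function of a finite poset (L, le) *)

Section Mobius.
Variables (T : choiceType) (L : {fset T}) (le : rel T).

(* mu(x, x) = 1 and mu(x, y) = - sum_(x <= z < y) mu(x, z) for x < y; the fuel
   k bounds the depth of the recursion, and #|L| is always enough (mobiusE). *)
Fixpoint mobius_rec (k : nat) (x y : T) : int :=
  if x == y then 1
  else if k is k'.+1 then
    if le x y then
      - \sum_(z <- L | [&& le x z, le z y & z != y]) mobius_rec k' x z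
    else 0
  else 0.

Definition mobius (x y : T) : int := mobius_rec #|` L| x y.

Lemma mobiusxx x : mobius x x = 1.
Proof. by rewrite /mobius; case: #|` L| => [|k] /=; rewrite eqxx. Qed.

Hypotheses (le_refl : reflexive le) (le_anti : antisymmetric le).
Hypothesis le_trans : transitive le.

Let below y := [fset z in L | le z y && (z != y)]%fset.

Let below_lt y z : z \in L -> le z y -> z != y ->
  (#|` below z| < #|` below y|)%N.
Proof.
move=> zL lezy nezy; apply: fproper_ltn_card; rewrite fproperE.
apply/andP; split; last first.
  by apply/fsubsetPn; exists z; rewrite !inE /= ?eqxx ?andbF // zL lezy.
apply/fsubsetP => t; rewrite !inE /= => /and3P[-> letz netz] /=.
rewrite (le_trans letz lezy) /=; apply: contraNneq netz => ety.
by apply/eqP/le_anti; rewrite letz ety lezy.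
Qed.

Let mobius_rec_fuel k k' x y : x \in L ->
  (#|` below y| <= k)%N -> (#|` below y| <= k')%N ->
  mobius_rec k x y = mobius_rec k' x y.
Proof.
move=> xL.
have no_fuel z : (#|` below z| <= 0)%N -> x != z -> le x z = false.
  move=> c0 nexz; apply/negP => lexz.
  by have := leq_trans (below_lt xL lexz nexz) c0; rewrite ltn0.
elim: k k' y => [|k IHk] [|k'] y //= ck ck'; case: eqVneq => // nexy.
- by rewrite no_fuel.
- by rewrite no_fuel.
case: ifP => // _; congr (- _); rewrite big_seq_cond [RHS]big_seq_cond.
apply: eq_bigr => z /and4P[zL _ lezy nezy].
by apply: IHk; rewrite -ltnS; [apply: leq_trans ck|apply: leq_trans ck'];
  apply: below_lt.
Qed.

Lemma mobiusE x y : x \in L -> y \in L -> le x y -> x != y ->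
  mobius x y = - \sum_(z <- L | [&& le x z, le z y & z != y]) mobius x z.
Proof.
move=> xL yL lexy nexy; rewrite {1}/mobius.
have c_le z : (#|` below z| <= #|` L|)%N.
  by apply: fsubset_leq_card; apply/fsubsetP => t; rewrite !inE => /andP[].
rewrite (@mobius_rec_fuel _ #|` L|.+1) //= ?(leqW (c_le _)) //.
by rewrite (negPf nexy) lexy.
Qed.

End Mobius.

(** * Arrangements of linear subspaces and their characteristic polynomials *)

Section Arrangements.
Variables (K : fieldType) (V : vectType K).
Implicit Type A : {fset {vspace V}}.

(* The empty subfamily contributes the whole space. *)
Definition inter_lattice A : {fset {vspace V}} :=
  [fset (\bigcap_(U <- enum_fset B) U)%VS |
    B : {fset {vspace V}} in fpowerset A]%fset.

Definition rev_incl : rel {vspace V} := fun U W => (W <= U)%VS.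

Definition antichain A : Prop :=
  forall U W, U \in A -> W \in A -> (U <= W)%VS -> U = W.

Definition char_poly_arr A : {poly int} :=
  \sum_(Y <- inter_lattice A)
    mobius (inter_lattice A) rev_incl fullv Y *: 'X^(\dim Y).

Definition arr_dim A : nat := \max_(U <- A) \dim U.

End Arrangements.

(** * Face enumeration of cell decompositions of spheres *)

Section Faces.
Variables (K : fieldType) (V : vectType K).
Implicit Types (F : set V) (D : {fset set V}).

Definition is_linspan F (W : {vspace V}) : Prop :=
  (forall x, F x -> x \in W) /\
  (forall W' : {vspace V}, (forall x, F x -> x \in W') -> (W <= W')%VS).

Definition linspan F : {vspace V} := xget fullv (is_linspan F).

Lemma linspanP F : is_linspan F (linspan F).
Proof.
apply: xgetPex.
pose P k := `[< exists2 W : {vspace V}, \dim W = k & forall x, F x -> x \in W >].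
have exP : exists k, P k.
  by exists (\dim {:V}); apply/asboolP; exists fullv => // x _; rewrite memvf.
have [k /asboolP[W dimW FW] kmin] := ex_minnP exP.
exists W; split=> // W' FW'.
have capF : forall x, F x -> x \in (W :&: W')%VS.
  by move=> x Fx; rewrite memv_cap FW ?FW'.
have le_dim : (\dim W <= \dim (W :&: W')%VS)%N.
  by rewrite dimW; apply: kmin; apply/asboolP; exists (W :&: W')%VS.
suff <- : (W :&: W')%VS = W by rewrite capvSr.
by apply/eqP; rewrite eqEdim capvSl.
Qed.

(* A spherical cell F of dimension i spans a linear space of dimension i + 1;
   the empty face set0 has dimension -1. Thus face_rank F = dim F + 1. *)
Definition face_rank F : nat := \dim (linspan F).

(* fnum D i is the number f_(i-1) of (i-1)-dimensional faces of D. *)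
Definition fnum D (i : nat) : nat :=
  #|` [fset F in D | face_rank F == i]%fset|.

(* The number d such that D has dimension d - 1. *)
Definition complex_rank D : nat := \max_(F <- D) face_rank F.

Definition h_poly D : {poly int} :=
  let d := complex_rank D in
  \sum_(i < d.+1) (fnum D i)%:R *: ('X - 1) ^+ (d - i).

(* x^d h(D; 1/x), where h(D; x) has degree at most d. *)
Definition hbar_poly D : {poly int} :=
  let d := complex_rank D in
  \sum_(i < d.+1) (h_poly D)`_i *: 'X^(d - i).

End Faces.

(** * The arrangement B_n *)

Section TypeB.
Variables (R : realType) (n : nat).
Implicit Type A : {fset {vspace 'rV[R]_n}}.

(* inl i stands for x_i = 0, and inr (i, j, b) with i < j for
   x_i = (-1)^b x_j. *)
Definition B_index : finType :=
  ('I_n + {p : 'I_n * 'I_n * bool | (p.1.1 < p.1.2)%N})%type.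

Definition B_form (h : B_index) (x : 'rV[R]_n) : R^o :=
  match h with
  | inl i => x 0 i
  | inr p => x 0 (val p).1.1 - (-1) ^+ (val p).2 * x 0 (val p).1.2
  end.

Fact B_form_is_linear h : linear (B_form h).
Proof.
move=> a x y; case: h => [i|p] /=; first by rewrite !mxE.
by rewrite !mxE mulrDr scalerBr opprD addrACA mulrCA.
Qed.

HB.instance Definition _ h :=
  GRing.isLinear.Build R 'rV[R]_n R^o _ (B_form h) (B_form_is_linear h).

Definition B_hyperplane (h : B_index) : {vspace 'rV[R]_n} :=
  lker (linfun (B_form h)).

Lemma mem_B_hyperplane h x : (x \in B_hyperplane h) = (B_form h x == 0).
Proof. by rewrite memv_ker lfunE. Qed.

Definition B_arr : {fset {vspace 'rV[R]_n}} :=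
  [fset B_hyperplane h | h in B_index]%fset.

Definition tail_poly A : {poly int} := 'X^n - char_poly_arr A.

Definition embedded_in_B A : Prop :=
  {subset A <= inter_lattice B_arr} /\ antichain A.

Definition unit_sphere : set 'rV[R]_n := [set x | \sum_i x 0 i ^+ 2 = 1]%classic.

(* The value k : 'I_3 encodes the sign k - 1. *)
Definition B_cell (s : {ffun B_index -> 'I_3}) : set 'rV[R]_n :=
  [set x | unit_sphere x /\
           forall h, Num.sg (B_form h x) = (s h : nat)%:R - 1]%classic.

(* The empty face set0 is the cell of any sign vector that is not attained on
   the sphere, such as the zero sign vector. *)
Definition B_complex : {fset set 'rV[R]_n} :=
  [fset B_cell s | s in {ffun B_index -> 'I_3}]%fset.

Definition sub_complex A : {fset set 'rV[R]_n} :=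
  [fset F in B_complex |
    `[< forall x, F x -> exists2 U, U \in A & x \in U >]]%fset.

Definition hbar_arr A : {poly int} :=
  if A == fset0 then 0 else hbar_poly (sub_complex A).

End TypeB.

Arguments B_arr R n : clear implicits.
Arguments B_complex R n : clear implicits.

(* Main.v *)
Require Import Defs.
From mathcomp Require Import all_boot all_order all_algebra.
From mathcomp Require Import finmap boolp classical_sets reals.
From mathcomp Require Import zify ring lra.

(** Both sides count the points of {-m, ..., m}^n that lie on the union of A.

    On the right, Möbius inversion over the intersection lattice of A writes
    the number of points off the union as the sum of mu(R^n, Y) times the
    number of points on Y. Each Y is an intersection of hyperplanes of B_n, so
    Y is cut out by equations x_i = 0 and x_i = +-x_j, and carries exactly
    (2m+1)^(dim Y) of the points.

    On the left, hbar / (1-x)^(d+1) is the sum over the faces F, of rank r, of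
    x^r / (1-x)^(r+1), whose coefficients are the binomials C(m, r). And C(m, r)
    is the number of points of {-m, ..., m}^n in the open cone over F: such a
    point is determined by its r distinct nonzero absolute values, the signs
    and the order of the absolute values of the coordinates being prescribed
    by F. The empty face accounts for the origin.

    A cell through x spans the flat of x, i.e. the intersection of the
    hyperplanes containing x, and every intersection of hyperplanes is the flat
    of a generic point; hence the two notions of dimension agree. *)

Set Implicit Arguments.
Unset Strict Implicit.
Unset Printing Implicit Defensive.

Import Order.TTheory GRing.Theory Num.Theory.

Local Open Scope ring_scope.

(** * Generating functions *)

Section TruncatedSeries.
Variable K : comUnitRingType.
Implicit Types p q : {poly K}.

(** Congruence modulo X^(M+1). A coefficient of a series identity involves finitely many terms, so
    it can be checked on truncations, in the polynomial ring. *)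
Definition eq_upto (M : nat) p q := forall i, (i <= M)%N -> p`_i = q`_i.

Lemma eq_upto_mul M p p' q q' :
  eq_upto M p p' -> eq_upto M q q' -> eq_upto M (p * q) (p' * q').
Proof.
move=> epp eqq i le_iM; rewrite !coefM; apply: eq_bigr => j _.
rewrite epp ?eqq //; first exact: leq_trans (leq_subr _ _) le_iM.
exact: leq_trans (leq_ord j) le_iM.
Qed.

Definition bin_series (M r : nat) : {poly K} := \poly_(i < M.+1) 'C(i, r)%:R.

Lemma bin_series_mul M r :
  eq_upto M ((1 - 'X) ^+ r.+1 * bin_series M r) 'X^r.
Proof.
elim: r => [|r IHr] i le_iM.
  rewrite expr1 mulrBl mul1r coefB coefXM !coef_poly coefXn.
  case: i le_iM => [|i] le_iM /=; first by rewrite bin0 subr0.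
  by rewrite !ltnS le_iM (ltnW le_iM) !bin0 subrr.
(* Pascal's rule, coefficient by coefficient. *)
have step : eq_upto M ((1 - 'X) * bin_series M r.+1) ('X * bin_series M r).
  move=> j le_jM; rewrite mulrBl mul1r coefB !coefXM !coef_poly ltnS le_jM.
  case: j le_jM => [|j] le_jM /=; first by rewrite bin0n subr0.
  by rewrite ltnS (ltnW le_jM) binS natrD addrAC subrr add0r.
have -> : ((1 - 'X) ^+ r.+2 * bin_series M r.+1)`_i
        = ((1 - 'X) ^+ r.+1 * ('X * bin_series M r))`_i.
  by rewrite exprSr -mulrA (eq_upto_mul (fun _ _ => erefl) step).
by rewrite mulrCA [in RHS]exprS (eq_upto_mul (fun _ _ => erefl) IHr).
Qed.

(** Coefficient m of a product only sees the coefficients of [g] up to m, so [g] may be truncated at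
    any order M >= m. *)
Lemma fps_mul_of_poly p (g : nat -> K) M m : (m <= M)%N ->
  fps_mul (fps_of_poly p) g m = (p * \poly_(i < M.+1) g i)`_m.
Proof.
move=> le_mM; rewrite coefM; apply: eq_bigr => i _.
by rewrite coef_poly ltnS (leq_trans (leq_subr _ _) le_mM).
Qed.

(* X^r (1-X)^(d-r) / (1-X)^(d+1) = X^r / (1-X)^(r+1) = sum_m C(m,r) X^m *)
Lemma fps_div_bin d r m : (r <= d)%N ->
  fps_div (fps_of_poly ('X^r * (1 - 'X) ^+ (d - r) : {poly K}))
          (fps_of_poly ((1 - 'X) ^+ d.+1)) m = 'C(m, r)%:R.
Proof.
move=> le_rd; set P := fps_of_poly (_ ^+ d.+1).
have P0 : P 0%N = 1.
  rewrite /P /fps_of_poly -horner_coef0 horner_exp !hornerE.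
  by rewrite subr0 expr1n.
have Pinv : eq_upto m ((1 - 'X) ^+ d.+1 * \poly_(i < m.+1) fps_inv P i) 1.
  move=> i le_im; rewrite -(fps_mul_of_poly _ _ le_im) fps_mulfV ?coef1 //.
  by rewrite -/P P0 unitr1.
rewrite /fps_div (fps_mul_of_poly _ _ (leqnn m)).
(* The numerator is congruent to [bin_series m r] times the denominator, which [Pinv] then
   cancels. *)
have e : eq_upto m ('X^r * (1 - 'X) ^+ (d - r))
    (bin_series m r * (1 - 'X) ^+ d.+1).
  move=> i le_im; have -> : d.+1 = (r.+1 + (d - r))%N by lia.
  rewrite exprD mulrA [bin_series _ _ * _]mulrC.
  by rewrite (eq_upto_mul (@bin_series_mul m r) (fun _ _ => erefl)).
rewrite (eq_upto_mul e (fun _ _ => erefl)) // -mulrA.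
rewrite (eq_upto_mul (fun _ _ => erefl) Pinv) // mulr1.
by rewrite coef_poly ltnS leqnn.
Qed.

Lemma fps_divZ_sum (I : finType) (c : I -> K) (p : I -> {poly K})
    (g : nat -> K) m :
  fps_div (fps_of_poly (\sum_i c i *: p i)) g m
  = \sum_i c i * fps_div (fps_of_poly (p i)) g m.
Proof.
rewrite /fps_div (fps_mul_of_poly _ _ (leqnn m)) mulr_suml coef_sum.
apply: eq_bigr => i _; rewrite -scalerAl coefZ.
by rewrite -(fps_mul_of_poly _ _ (leqnn m)).
Qed.

End TruncatedSeries.

(** * The reversed h-polynomial as a sum over faces *)

Lemma coef_XsubC1_exp (e j : nat) : (j <= e)%N ->
  (('X - 1) ^+ e : {poly int})`_j = (-1) ^+ (e - j) *+ 'C(e, j).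
Proof.
move=> le_je; rewrite addrC exprDn coef_sum.
rewrite (bigD1 (Ordinal (le_je : (j < e.+1)%N))) //= big1 => [|i ne_ij].
  by rewrite addr0 coefMn -[-1]/(- 1%:P) -polyCN -polyC_exp coefCM coefXn eqxx mulr1.
rewrite coefMn -[-1]/(- 1%:P) -polyCN -polyC_exp coefCM coefXn.
case: eqP => [e_ij|]; last by rewrite mulr0 mul0rn.
by case/negP: ne_ij; apply/eqP/val_inj.
Qed.

Lemma coef_1subX_exp (e j : nat) :
  ((1 - 'X) ^+ e : {poly int})`_j = (-1) ^+ j *+ 'C(e, j).
Proof.
have -> : (1 - 'X) ^+ e = (-1)%:P ^+ e * ('X - 1) ^+ e :> {poly int}.
  by rewrite -exprMn polyCN mulN1r opprB.
rewrite -polyC_exp coefCM; case: (leqP j e) => [le_je|lt_ej].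
  rewrite coef_XsubC1_exp // mulrnAr.
  congr (_ *+ _); rewrite -{1}(subnK le_je) exprD mulrAC -expr2 sqrr_sign.
  by rewrite mul1r.
rewrite bin_small // nth_default ?mulr0 //.
by rewrite size_exp_XsubC.
Qed.

Section HBar.
Variables (K : fieldType) (V : vectType K) (D : {fset set V}).

(** Substituting 1/x in (x-1)^(d-i) and multiplying by x^d gives x^i (1-x)^(d-i). As [hbar_poly]
    reverses a list of coefficients, the identity is checked on coefficients. *)
Lemma hbar_polyE : hbar_poly D =
  \sum_(i < (complex_rank D).+1)
     (fnum D i)%:R *: ('X^i * (1 - 'X) ^+ (complex_rank D - i)).
Proof.
rewrite /hbar_poly /h_poly; set d := complex_rank D.
have -> : \sum_(j < d.+1) (\sum_(i < d.+1)
            (fnum D i)%:R *: ('X - 1) ^+ (d - i) : {poly int})`_j *: 'X^(d - j)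
  = \sum_(i < d.+1) (fnum D i)%:R *:
      (\sum_(j < d.+1) (('X - 1) ^+ (d - i) : {poly int})`_j *: 'X^(d - j)).
  under eq_bigr => j _ do rewrite coef_sum scaler_suml.
  rewrite exchange_big /=; apply: eq_bigr => i _; rewrite scaler_sumr.
  by apply: eq_bigr => j _; rewrite coefZ scalerA.
apply: eq_bigr => i _; congr (_ *: _); apply/polyP => l.
have le_id : (i <= d)%N by rewrite -ltnS.
rewrite coef_sum coefXnM coef_1subX_exp.
case: (leqP l d) => [le_ld|lt_dl]; last first.
  rewrite bin_small ?mulr0n ?if_same; last by lia.
  rewrite big1 // => j _; rewrite coefZ coefXn.
  by case: eqP => [e|]; rewrite ?mulr0 //; lia.
(* For l <= d only j = d - l contributes to the coefficient of X^l. *)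
rewrite (bigD1 (Ordinal (leq_subr l d : (d - l < d.+1)%N))) //= big1 ?addr0.
  rewrite coefZ coefXn subKn // eqxx mulr1.
  case: ltnP => [lt_li|le_il].
    by rewrite nth_default // (size_exp_XsubC _ 1); lia.
  rewrite coef_XsubC1_exp; last by lia.
  have -> : (d - i - (d - l) = l - i)%N by lia.
  by rewrite -(bin_sub (_ : l - i <= d - i)%N); [congr (_ *+ 'C(_, _)) |]; lia.
move=> j /eqP ne_j; rewrite coefZ coefXn; case: eqP => [e|]; rewrite ?mulr0 //.
by case: ne_j; apply/val_inj => /=; have := ltn_ord j; lia.
Qed.

Lemma hbar_poly_series m :
  fps_div (fps_of_poly (hbar_poly D))
          (fps_of_poly ((1 - 'X) ^+ (complex_rank D).+1)) m
  = (\sum_(F <- D) 'C(m, face_rank F))%N%:R.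
Proof.
rewrite hbar_polyE fps_divZ_sum.
have rankF F : F \in D -> (face_rank F < (complex_rank D).+1)%N.
  by move=> FD; rewrite ltnS; rewrite /complex_rank (big_rem F FD) leq_maxl.
transitivity ((\sum_(i < (complex_rank D).+1) fnum D i * 'C(m, i))%N%:R : int).
  rewrite natr_sum; apply: eq_bigr => i _.
  by rewrite fps_div_bin ?natrM // -ltnS.
(* Group the faces by rank. *)
congr (_%:R); transitivity (\sum_(i < (complex_rank D).+1)
    \sum_(F <- D | face_rank F == i :> nat) 'C(m, face_rank F))%N.
  apply: eq_bigr => i _; rewrite /fnum -sum1_size.
  rewrite [RHS](eq_bigr (fun=> (1 * 'C(m, i))%N)); last by move=> F /eqP ->; rewrite mul1n.
  by rewrite -big_distrl /= -big_fset_condE.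
rewrite (exchange_big_dep predT) //= big_seq [RHS]big_seq.
apply: eq_bigr => F FD; rewrite (bigD1 (Ordinal (rankF F FD))) //=.
rewrite big1 ?addn0 // => i /andP[/eqP e ne].
by case/negP: ne; apply/eqP/val_inj.
Qed.

End HBar.

(** * Möbius inversion at a point *)

Section MobiusPoint.
Variables (K : fieldType) (V : vectType K) (A : {fset {vspace V}}).

Lemma mem_bigcapv (s : seq {vspace V}) (P : pred {vspace V}) x :
  (x \in (\bigcap_(U <- s | P U) U)%VS) = all (fun U => P U ==> (x \in U)) s.
Proof.
elim: s => [|U s IHs]; first by rewrite big_nil memvf.
by rewrite big_cons /=; case: (P U); rewrite ?memv_cap IHs.
Qed.

Lemma mem_inter_latticeP Y :
  reflect (exists2 B : {fset {vspace V}}, {subset B <= A}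
             & Y = (\bigcap_(U <- enum_fset B) U)%VS)
          (Y \in inter_lattice A).
Proof.
apply: (iffP idP) => [/imfsetP[B /= BA ->]|[B BA ->]].
  by exists B => //; apply/fsubsetP; rewrite -fpowersetE.
by apply/imfsetP; exists B => //=; rewrite fpowersetE; apply/fsubsetP.
Qed.

Lemma fullv_inter_lattice : fullv \in inter_lattice A.
Proof.
by apply/mem_inter_latticeP; exists fset0 => //; rewrite big_seq_fset0.
Qed.

(** In reverse inclusion, the members of the lattice through x form the interval from [fullv] to
    [Yx], the intersection of the members of [A] through x. The Möbius sum over it is 0 unless it is
    a single element; since [fullv] is not in [A], that happens exactly when x is off the union. *)
Lemma mobius_point (x : V) : fullv \notin A ->
  \sum_(Y <- inter_lattice A | x \in Y)
     mobius (inter_lattice A) (@rev_incl _ V) fullv Y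
  = (~~ has (fun U : {vspace V} => x \in U) (enum_fset A))%:R.
Proof.
move=> properA; set L := inter_lattice A.
pose Ax := [fset U in A | x \in U]%fset.
pose Yx := (\bigcap_(U <- enum_fset Ax) U)%VS.
have YxL : Yx \in L.
  apply/mem_inter_latticeP; exists Ax => // U.
  by rewrite !inE => /andP[].
have xYx : x \in Yx.
  by rewrite mem_bigcapv; apply/allP => U /=; rewrite !inE => /andP[].
have YxS U : U \in A -> x \in U -> (Yx <= U)%VS.
  move=> UA xU; apply/subvP => y; rewrite mem_bigcapv => /allP/(_ U) /=.
  by apply; rewrite !inE UA.
have xL Y : Y \in L -> (x \in Y) = (Yx <= Y)%VS.
  move=> /mem_inter_latticeP[B BA ->]; apply/idP/idP => [|/subvP]; last exact.
  rewrite mem_bigcapv => /allP /= xB; apply/subvP => y yYx.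
  rewrite mem_bigcapv; apply/allP => U UB /=.
  by apply: (subvP (YxS U (BA _ UB) (xB _ UB))).
rewrite big_seq_cond (eq_bigl (fun Y => (Y \in L) && (Yx <= Y)%VS)); last first.
  by move=> Y; case: (boolP (Y \in L)) => //= YL; rewrite xL.
rewrite -big_seq_cond.
have [Yxf|Yxf] := eqVneq Yx fullv.
  have -> : has (fun U : {vspace V} => x \in U) (enum_fset A) = false.
    apply/hasPn => U UA; apply/negP => xU; case/negP: properA.
    have := YxS U UA xU; rewrite Yxf => fU.
    by rewrite -(_ : U = fullv) //; apply/eqP; rewrite eqEsubv subvf.
  rewrite big_mkcond (bigD1_seq fullv) ?fullv_inter_lattice ?fset_uniq //=.
  rewrite subvf mobiusxx big1 ?addr0 // => Y /eqP; rewrite Yxf.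
  by case: ifP => // fY []; apply/eqP; rewrite eqEsubv subvf.
have -> : has (fun U : {vspace V} => x \in U) (enum_fset A).
  apply: contraNT Yxf => /hasPn noU; rewrite /Yx big1_seq // => U /=.
  by rewrite !inE => /andP[UA xU]; case/negP: (noU U UA).
(* By the recursion for the Möbius function, the term at [Yx] cancels all the others. *)
rewrite big_mkcond (bigD1_seq Yx) ?fset_uniq //= subvv mobiusE //.
- rewrite -big_mkcondr addrC; apply/eqP; rewrite subr_eq0; apply/eqP.
  by apply: eq_bigl => Y; rewrite /rev_incl subvf andbC.
- by move=> U W; rewrite /rev_incl => WU; apply/eqP; rewrite eqEsubv andbC.
- by move=> U W Z /= UW WZ; apply: subv_trans WZ UW.
- exact: fullv_inter_lattice.
- exact: subvf.
- by rewrite eq_sym.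
Qed.

End MobiusPoint.

(** * Flats and cells *)

Lemma small_perturbation (R : realFieldType) (I : finType) (a b : I -> R) :
  exists2 e, 0 < e & forall i, a i != 0 -> Num.sg (a i + e * b i) = Num.sg (a i).
Proof.
(* S exceeds |b i| / |a i| whenever a i is nonzero, so e = 1/S gives |e b i| < |a i|. Terms with a i
   = 0 vanish by the convention on division. *)
pose S := 1 + \sum_i `|b i| / `|a i|.
have S_ge0 i : 0 <= `|b i| / `|a i| by apply: divr_ge0.
have S_gt0 : 0 < S by apply: ltr_pwDl => //; apply: sumr_ge0.
exists S^-1; first by rewrite invr_gt0.
move=> i ai0; have ai_gt0 : 0 < `|a i| by rewrite normr_gt0.
have lt_ba : `|S^-1 * b i| < `|a i|.
  rewrite normrM gtr0_norm ?invr_gt0 // ltr_pdivrMl // -ltr_pdivrMr //.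
  rewrite /S (bigD1 i) //=.
  have : 0 <= \sum_(j | j != i) `|b j| / `|a j| by apply: sumr_ge0.
  by move: (\sum_(_ | _) _) => s s0; lra.
have := lt_ba; rewrite ltr_norml; case/andP.
case: (ltrgt0P (a i)) ai0 => // ai _ lo hi.
  by rewrite !gtr0_sg //; lra.
by rewrite !ltr0_sg //; lra.
Qed.

Lemma eq_sgr (R : realDomainType) (u v : R) :
  (0 < u) = (0 < v) -> (u < 0) = (v < 0) -> Num.sg u = Num.sg v.
Proof.
case: (ltrgt0P u) => [u0|u0|->]; case: (ltrgt0P v) => [v0|v0|->] //= _ _.
  by rewrite !gtr0_sg.
by rewrite !ltr0_sg.
Qed.

(** If a and b have different signs, these decide the sign of a - b; otherwise the absolute values
    do. It will give the signs of the forms x_i - tau x_j. *)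
Lemma sgr_sub_eq (R : realDomainType) (a b a' b' : R) :
  Num.sg a = Num.sg a' -> Num.sg b = Num.sg b' ->
  (`|a| < `|b|) = (`|a'| < `|b'|) -> (`|b| < `|a|) = (`|b'| < `|a'|) ->
  Num.sg (a - b) = Num.sg (a' - b').
Proof.
move=> ea eb; have := (sgr_gt0 a, sgr_lt0 a, sgr_gt0 b, sgr_lt0 b).
rewrite ea eb !sgr_gt0 !sgr_lt0 => -[[[]]].
case: (ltrgt0P a) => ha; case: (ltrgt0P a') => ha' //= _ _;
case: (ltrgt0P b) => hb; case: (ltrgt0P b') => hb' //= _ _;
rewrite ?ltrN2 => h1 h2; apply: eq_sgr; rewrite ?subr_gt0 ?subr_lt0 //;
by apply/idP/idP; lra.
Qed.

Section Geometry.
Variables (R : realType) (n : nat).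
Local Notation V := 'rV[R]_n.
Implicit Types (x y u : V) (Y : {vspace V}) (h : B_index n).

Definition flat x : {vspace V} :=
  (\bigcap_(h | B_form h x == 0%R) B_hyperplane R h)%VS.

Lemma memv_bigcap (I : finType) (P : pred I) (F : I -> {vspace V}) y :
  reflect (forall i, P i -> y \in F i) (y \in (\bigcap_(i | P i) F i)%VS).
Proof.
rewrite memvE; apply: (iffP subv_bigcapP) => yF i Pi.
  by rewrite memvE yF.
by rewrite -memvE yF.
Qed.

Lemma mem_flatP x y :
  reflect (forall h, B_form h x = 0 -> B_form h y = 0) (y \in flat x).
Proof.
apply: (iffP (memv_bigcap _ _ _)) => xy h.
  by move=> hx; apply/eqP; rewrite -mem_B_hyperplane xy // hx.
by move/eqP => hx; rewrite mem_B_hyperplane xy.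
Qed.

(* Y is the intersection of the hyperplanes of B_n that contain it. *)
Definition B_closed Y := forall y,
  (forall h, (Y <= B_hyperplane R h)%VS -> B_form h y = 0) -> y \in Y.

Lemma B_closed_bigcap (s : seq {vspace V}) :
  (forall U, U \in s -> B_closed U) -> B_closed (\bigcap_(U <- s) U)%VS.
Proof.
move=> s_cl y sy; rewrite mem_bigcapv; apply/allP => U Us /=.
apply: s_cl => // h Uh; apply: sy; apply: subv_trans Uh.
by apply/subvP => z; rewrite mem_bigcapv => /allP/(_ U Us).
Qed.

Lemma B_closed_inter_lattice (A : {fset {vspace V}}) :
  (forall U, U \in A -> B_closed U) ->
  forall Y, Y \in inter_lattice A -> B_closed Y.
Proof.
move=> A_cl Y /mem_inter_latticeP[B BA ->].
by apply: B_closed_bigcap => U /BA /A_cl.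
Qed.

(** Closedness passes from the hyperplanes to their intersections, hence to the members of [A], and
    then to the intersections of these. *)
Lemma B_closed_embedded (A : {fset {vspace V}}) Y :
  embedded_in_B A -> Y \in inter_lattice A -> B_closed Y.
Proof.
move=> [AL _]; apply: B_closed_inter_lattice => U /AL.
apply: B_closed_inter_lattice => H /imfsetP[h _ ->] y hy.
by rewrite mem_B_hyperplane hy.
Qed.

Lemma B_form_perturb x u : exists2 e : R, 0 < e &
  forall h, B_form h x != 0 ->
    Num.sg (B_form h (x + e *: u)) = Num.sg (B_form h x).
Proof.
have [e e0 eP] := small_perturbation (fun h => B_form h x) (fun h => B_form h u).
by exists e => // h hx; rewrite linearD linearZ /= eP.
Qed.

(** The hyperplanes are treated one at a time: if x lies on the next one, a small step inside Y
    along some u off it leaves it, and keeps the signs of the forms already nonzero. *)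
Lemma generic_point Y (s : seq (B_index n)) : exists2 x, x \in Y &
  forall h, h \in s -> ~~ (Y <= B_hyperplane R h)%VS -> B_form h x != 0.
Proof.
elim: s => [|h s [x xY xs]]; first by exists 0; rewrite ?mem0v.
have [Yh|/subvPn[u uY uh]] := boolP (Y <= B_hyperplane R h)%VS.
  by exists x => // h'; rewrite inE => /predU1P[->|/xs //]; rewrite Yh.
have [hx0|hx] := eqVneq (B_form h x) 0; last first.
  by exists x => // h'; rewrite inE => /predU1P[->|/xs].
have [e e0 eP] := B_form_perturb x u.
exists (x + e *: u); first by rewrite memvD ?memvZ.
move=> h'; rewrite inE => /predU1P[-> _|h's Yh'].
  rewrite linearD linearZ /= hx0 add0r.
  by rewrite mem_B_hyperplane in uh; rewrite mulf_neq0 // gt_eqF.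
by rewrite -sgr_eq0 eP ?sgr_eq0 xs.
Qed.

Lemma B_closed_flat Y : B_closed Y -> exists2 x, x \in Y & Y = flat x.
Proof.
move=> Ycl; have [x xY gen] := generic_point Y (enum (B_index n)).
exists x => //; apply/eqP; rewrite eqEsubv; apply/andP; split; apply/subvP => y.
  move=> yY; apply/mem_flatP => h hx.
  have [Yh|Yh] := boolP (Y <= B_hyperplane R h)%VS.
    by apply/eqP; rewrite -mem_B_hyperplane (subvP Yh).
  by move: (gen h (mem_enum _ _) Yh); rewrite hx eqxx.
move/mem_flatP => yx; apply: Ycl => h Yh; apply: yx.
by apply/eqP; rewrite -mem_B_hyperplane (subvP Yh).
Qed.

(** * Cells as sign classes of points *)

Definition same_sign x y :=
  [forall h : B_index n, Num.sg (B_form h x) == Num.sg (B_form h y)].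

Lemma same_signP x y :
  reflect (forall h, Num.sg (B_form h x) = Num.sg (B_form h y)) (same_sign x y).
Proof. by apply: (iffP forallP) => xy h; apply/eqP. Qed.

Lemma same_sign_flat x y : same_sign x y -> y \in flat x.
Proof.
move/same_signP => xy; apply/mem_flatP => h hx.
by apply/eqP; rewrite -sgr_eq0 -xy hx sgr0.
Qed.

(** Cells are indexed by a point of their open cone instead of a sign vector. The point x need not
    lie on the sphere, and the origin yields the empty face. *)
Definition cell_of x : set V :=
  [set y | unit_sphere y /\ same_sign y x]%classic.

Lemma scale_same_sign (c : R) x : 0 < c -> same_sign (c *: x) x.
Proof.
by move=> c0; apply/same_signP => h; rewrite linearZ sgrM gtr0_sg // mul1r.
Qed.

Lemma normalize x : x != 0 -> exists2 c : R, 0 < c & unit_sphere (c *: x).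
Proof.
move=> x0; pose N := \sum_i x 0 i ^+ 2.
have N_ge0 : 0 <= N by apply: sumr_ge0 => i _; apply: sqr_ge0.
have N0 : N != 0.
  apply: contraNneq x0 => N0; apply/eqP/rowP => i; rewrite mxE.
  move/eqP: N0; rewrite psumr_eq0 => [/allP/(_ i (mem_index_enum _))|j _].
    by rewrite sqrf_eq0 => /eqP.
  exact: sqr_ge0.
have N_gt0 : 0 < N by rewrite lt_neqAle eq_sym N0.
exists (Num.sqrt N)^-1; first by rewrite invr_gt0 sqrtr_gt0.
rewrite /unit_sphere /=; under eq_bigr => i _ do rewrite mxE exprMn.
by rewrite -mulr_sumr -/N exprVn sqr_sqrtr // mulVf.
Qed.

Lemma unit_sphere_neq0 x : unit_sphere x -> x != 0.
Proof.
rewrite /unit_sphere /= => x1; apply: contra_eq_neq x1 => ->.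
rewrite big1 => [|i _]; first by rewrite eq_sym oner_neq0.
by rewrite mxE expr0n.
Qed.

Lemma same_sign0 x : same_sign x 0 -> x = 0.
Proof.
move/same_signP => x0; apply/rowP => i; rewrite mxE.
by apply/eqP; rewrite -sgr_eq0 (x0 (inl i)) linear0 sgr0.
Qed.

Lemma same_sign_sym x y : same_sign x y = same_sign y x.
Proof. by apply: eq_forallb => h; rewrite eq_sym. Qed.

Lemma same_sign_trans y x z : same_sign x y -> same_sign y z -> same_sign x z.
Proof.
by move=> /same_signP xy /same_signP yz; apply/same_signP => h; rewrite xy.
Qed.

Lemma cell_of_neq0 x : x != 0 -> exists2 c : R, 0 < c & cell_of x (c *: x).
Proof.
by move=> /normalize[c c0 xc]; exists c => //; split=> //; apply: scale_same_sign.
Qed.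

Lemma cell_of0 : cell_of 0 = set0.
Proof.
rewrite -subset0 => y [y1 /same_sign0 y0].
by case/negP: (unit_sphere_neq0 y1); rewrite y0.
Qed.

Lemma cell_of_eq x y : (cell_of x = cell_of y) <-> same_sign x y.
Proof.
split=> [exy|xy]; last first.
  rewrite predeqE => z; split=> -[z1 zx]; split=> //.
    exact: same_sign_trans zx xy.
  by apply: same_sign_trans zx _; rewrite same_sign_sym.
have [y0|/cell_of_neq0[c c0 cy]] := eqVneq y 0.
  have [->|/cell_of_neq0[c c0]] := eqVneq x 0.
    by rewrite y0; apply/same_signP.
  by rewrite exy y0 cell_of0.
have [_ cx] : cell_of x (c *: y) by rewrite exy.
by case: cy => _; apply: same_sign_trans; rewrite same_sign_sym.
Qed.

Lemma B_cellE (s : {ffun B_index n -> 'I_3}) : exists x, B_cell s = cell_of x.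
Proof.
have [[x sx]|s0] := pselect (exists x, B_cell s x).
  exists x; case: sx => _ sx; rewrite predeqE => y; split=> -[y1 sy]; split=> //.
    by apply/same_signP => h; rewrite sy sx.
  by move/same_signP: sy => sy h; rewrite sy sx.
(* A sign vector not attained on the sphere gives the empty face. *)
exists 0; rewrite cell_of0 -subset0 => x sx.
by apply: s0; exists x.
Qed.

Lemma cell_of_B x : cell_of x \in B_complex R n.
Proof.
pose s := [ffun h : B_index n => if B_form h x < 0 then 0 else
  if B_form h x == 0 then 1 else 2%:R : 'I_3].
have sx h : Num.sg (B_form h x) = (s h : nat)%:R - 1.
  rewrite ffunE; case: (ltrgt0P (B_form h x)) => [hx|hx|->].
  - by rewrite gtr0_sg //= addrK.
  - by rewrite ltr0_sg //= sub0r.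
  - by rewrite sgr0 /= subrr.
apply/imfsetP; exists s => //; rewrite predeqE => y; split=> -[y1 sy]; split=> //.
  by move/same_signP: sy => sy h; rewrite sy sx.
by apply/same_signP => h; rewrite sy sx.
Qed.

Lemma flat0 : flat 0 = 0%VS.
Proof.
apply/eqP; rewrite -subv0; apply/subvP => y /mem_flatP y0.
rewrite memv0; apply/eqP/rowP => i; rewrite mxE.
by apply: (y0 (inl i)); rewrite linear0.
Qed.

(** The cone over the cell is relatively open in the flat of x, so it spans the flat. *)
Lemma face_rank_cell x : face_rank (cell_of x) = \dim (flat x).
Proof.
rewrite /face_rank; have [Fs min] := linspanP (cell_of x).
congr (\dim _); apply/eqP; rewrite eqEsubv; apply/andP; split.
  by apply: min => y [_]; rewrite same_sign_sym; apply: same_sign_flat.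
have [->|x0] := eqVneq x 0; first by rewrite flat0 sub0v.
have inW y : same_sign y x -> y \in linspan (cell_of x).
  move=> yx; have y0 : y != 0.
    apply: contraNneq x0 => y0; apply/eqP/same_sign0.
    by rewrite same_sign_sym -y0.
  have [c c0 [cy1 cy2]] := cell_of_neq0 y0.
  have : c *: y \in linspan (cell_of x).
    by apply: Fs; split=> //; apply: same_sign_trans cy2 yx.
  by move/(memvZ c^-1); rewrite scalerA mulVf ?scale1r // gt_eqF.
have xW : x \in linspan (cell_of x) by apply/inW/same_signP.
(* For u in the flat, x + e u has the signs of x: forms vanishing at x vanish at u, the others keep
   their sign for this e. So u is a multiple of a difference of two vectors of the span. *)
apply/subvP => u /mem_flatP xu; have [e e0 eP] := B_form_perturb x u.
have : x + e *: u \in linspan (cell_of x).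
  apply/inW/same_signP => h; have [hx|/eP //] := eqVneq (B_form h x) 0.
  by rewrite linearD linearZ /= hx xu // scaler0 addr0.
move/(memvB) => /(_ _ xW); rewrite addrAC subrr add0r.
by move/(memvZ e^-1); rewrite scalerA mulVf ?scale1r // gt_eqF.
Qed.

End Geometry.

(** * Parametrization of a flat by ranked absolute values *)

Section Ranks.
Variables (R : realType) (n : nat).
Local Notation V := 'rV[R]_n.
Implicit Types x y : V.

(* [io j] is the rank of |x_j| among the distinct nonzero absolute values of the
   coordinates of x, and [None] if x_j = 0. *)
Lemma exists_abs_ranks x : exists k (io : 'I_n -> option 'I_k),
 [/\ forall j, (io j == None) = (x 0 j == 0),
     forall i j a b, io i = Some a -> io j = Some b ->
       (a < b)%N = (`|x 0 i| < `|x 0 j|)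
   & forall a, exists j, io j = Some a].
Proof.
pose vs : seq R := sort <=%R (undup [seq `|x 0 j| | j <- enum 'I_n & x 0 j != 0]).
have mem_vs j : (`|x 0 j| \in vs) = (x 0 j != 0).
  rewrite mem_sort mem_undup; apply/mapP/idP => [[i]|xj].
    rewrite mem_filter => /andP[xi _] eij.
    by rewrite -normr_eq0 eij normr_eq0.
  by exists j; rewrite // mem_filter xj mem_enum.
have vs_sorted : sorted <%R vs by rewrite sort_lt_sorted undup_uniq.
(* If x_j = 0, then |x_j| is not in [vs], its index is [size vs], and [insub] returns [None]. *)
exists (size vs), (fun j => insub (index `|x 0 j| vs)); split=> [j|i j a b|a].
- case: insubP => [u + _|]; rewrite index_mem mem_vs.
    by move/negPf => ->.
  by rewrite negbK => ->.
- case: insubP => // u ui eu [<-]; case: insubP => // v vj ev [<-] /=.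
  rewrite eu ev; move: ui vj; rewrite !index_mem => ui vj.
  apply/idP/idP; first exact: (sorted_ltn_index lt_trans vs_sorted).
  apply: contraTT; rewrite -leqNgt -leNgt leq_eqVlt => /predU1P[eij|].
    by rewrite -(nth_index 0 ui) -(nth_index 0 vj) eij.
  by move/(sorted_ltn_index lt_trans vs_sorted _ _ vj ui)/ltW.
- have : vs`_a \in vs by rewrite mem_nth.
  rewrite mem_sort mem_undup => /mapP[j _ ej]; exists j.
  rewrite -ej index_uniq // ?sort_uniq ?undup_uniq //.
  by rewrite insubT //= => ?; congr Some; apply: val_inj.
Qed.

(** The forms only cover i < j. The case i > j follows by exchanging the roles, and i = j with sign
    -1 forces x_i = 0, which is a form of the other kind. *)
Lemma flat_rel x y i j (b : bool) : y \in flat x ->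
  x 0 i = (-1) ^+ b * x 0 j -> y 0 i = (-1) ^+ b * y 0 j.
Proof.
move=> /mem_flatP xy.
have lt_rel (i' j' : 'I_n) : (i' < j')%N ->
    x 0 i' = (-1) ^+ b * x 0 j' -> y 0 i' = (-1) ^+ b * y 0 j'.
  move=> lt_ij /eqP; rewrite -subr_eq0 => /eqP e.
  apply/eqP; rewrite -subr_eq0; apply/eqP.
  by apply: (xy (inr (exist _ (i', j', b) lt_ij))).
case: (ltngtP i j) => [|lt_ji|/val_inj <-]; first exact: lt_rel.
  by move=> e; rewrite (lt_rel j i) ?signrMK // e signrMK.
case: b {lt_rel} => /=; rewrite ?expr1 ?expr0 ?mulN1r ?mul1r // => e.
have xi : x 0 i = 0 by lra.
by rewrite (xy (inl i) xi : y 0 i = 0) oppr0.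
Qed.

(** The comparison is the sign of x_j^2 - x_i^2, up to sign the product of the two forms x_i - x_j
    and x_i + x_j. *)
Lemma same_sign_norm x y i j : same_sign x y ->
  (`|x 0 i| < `|x 0 j|) = (`|y 0 i| < `|y 0 j|).
Proof.
move=> /same_signP xy.
suff sg_sq : Num.sg (x 0 j ^+ 2 - x 0 i ^+ 2) = Num.sg (y 0 j ^+ 2 - y 0 i ^+ 2).
  have sqE (z : V) : (`|z 0 i| < `|z 0 j|) = (0 < Num.sg (z 0 j ^+ 2 - z 0 i ^+ 2)).
    rewrite sgr_gt0 subr_gt0 -(real_normK (num_real (z 0 i))).
    by rewrite -(real_normK (num_real (z 0 j))) ltr_sqr ?nnegrE.
  by rewrite !sqE sg_sq.
have lt_sq (i' j' : 'I_n) : (i' < j')%N ->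
    Num.sg (x 0 i' ^+ 2 - x 0 j' ^+ 2) = Num.sg (y 0 i' ^+ 2 - y 0 j' ^+ 2).
  move=> lt_ij; rewrite !subr_sqr !sgrM.
  have := xy (inr (exist _ (i', j', false) lt_ij)).
  have := xy (inr (exist _ (i', j', true) lt_ij)).
  by rewrite /= !expr0 !expr1 !mulN1r !opprK !mul1r => -> ->.
case: (ltngtP i j) => [/lt_sq|/lt_sq //|/val_inj <-]; last by rewrite !subrr.
by rewrite -opprB sgrN => e; rewrite -[in RHS]opprB sgrN -e -!sgrN !opprB.
Qed.

Variables (x : V) (k : nat) (io : 'I_n -> option 'I_k).
Hypothesis io0 : forall j, (io j == None) = (x 0 j == 0).
Hypothesis io_lt : forall i j a b, io i = Some a -> io j = Some b ->
  (a < b)%N = (`|x 0 i| < `|x 0 j|).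
Hypothesis io_surj : forall a, exists j, io j = Some a.

Let io_neq0 j a : io j = Some a -> x 0 j != 0.
Proof. by rewrite -io0 => ->. Qed.

Let io_eq i j : x 0 i != 0 -> `|x 0 i| = `|x 0 j| -> io i = io j.
Proof.
move=> xi e; have xj : x 0 j != 0 by rewrite -normr_eq0 -e normr_eq0.
move: xi xj; rewrite -!io0; case ei: (io i) => [a|//] _.
case ej: (io j) => [b|//] _; congr Some; apply/val_inj/eqP.
rewrite eqn_leq leqNgt (io_lt ej ei) leqNgt (io_lt ei ej) e.
by rewrite ltxx.
Qed.

Let io_norm i j a : io i = Some a -> io j = Some a -> `|x 0 i| = `|x 0 j|.
Proof.
move=> ei ej; apply/eqP; rewrite eq_le !leNgt -(io_lt ei ej) -(io_lt ej ei).
by rewrite ltnn.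
Qed.

(** Coordinates of rank a get the common value z a, with the sign they have in x; this identifies
    R^k with the flat of x. *)
Definition param (z : 'I_k -> R) : V :=
  \row_j if io j is Some a then Num.sg (x 0 j) * z a else 0.

Lemma param_flat z : param z \in flat x.
Proof.
apply/mem_flatP => -[i|[[[i j] b] /= lt_ij]] /=; rewrite !mxE.
  by move=> xi; have := io0 i; rewrite xi eqxx; case: (io i).
move/eqP; rewrite subr_eq0 => /eqP e.
have [xi|xi] := eqVneq (x 0 i) 0.
  have xj : x 0 j = 0.
    by apply/eqP; rewrite -normr_eq0 -(normrMsign b) -e xi normr0.
  have := io0 i; have := io0 j; rewrite xi xj eqxx.
  by case: (io i) (io j) => [//|] [//|]; rewrite mulr0 subrr.
have eij : `|x 0 i| = `|x 0 j| by rewrite e normrMsign.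
rewrite -(io_eq xi eij); case: (io i) => [a|]; last by rewrite mulr0 subrr.
rewrite e sgrM mulrA; suff -> : Num.sg ((-1) ^+ b : R) = (-1) ^+ b.
  by rewrite subrr.
by case: (b); rewrite ?sgrN sgr1.
Qed.

Lemma flat_param y : y \in flat x -> exists z, y = param z.
Proof.
move=> yx; have [s sP] := choice io_surj.
(* z a is read off one chosen coordinate [s a] of rank a. Any other coordinate of that rank agrees
   with it up to a sign fixed by x. *)
exists (fun a => Num.sg (x 0 (s a)) * y 0 (s a)); apply/rowP => j; rewrite mxE.
case ej: (io j) => [a|]; last first.
  by apply: (mem_flatP _ _ yx (inl j)); apply/eqP; rewrite /= -io0 ej.
have xj := io_neq0 ej; have xs := io_neq0 (sP a).
have : `|x 0 j| = `|x 0 (s a)| by apply: io_norm ej (sP a).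
rewrite mulrA -sgrM.
move/eqP; rewrite eqr_norm2 => /orP[]/eqP e.
  have -> : y 0 j = y 0 (s a).
    by rewrite (flat_rel (b := false) (j := s a) yx) expr0 mul1r.
  by rewrite e gtr0_sg ?mul1r // -expr2 exprn_even_gt0.
have -> : y 0 j = - y 0 (s a).
  by rewrite (flat_rel (b := true) (j := s a) yx) expr1 mulN1r.
by rewrite e mulNr sgrN gtr0_sg ?mulN1r // -expr2 exprn_even_gt0.
Qed.

(** [param] is linear, given by the matrix [M], has image the flat, and is injective because every
    rank is attained. *)
Lemma dim_flat : \dim (flat x) = k.
Proof.
pose M : 'M[R]_(k, n) :=
  \matrix_(a, j) if io j == Some a then Num.sg (x 0 j) else 0.
have MP (v : 'rV_k) : v *m M = param (v 0).
  apply/rowP => j; rewrite !mxE; case ej: (io j) => [a|].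
    rewrite (bigD1 a) //= big1 => [|b ne_ba].
      by rewrite mxE ej eqxx addr0 mulrC.
    rewrite mxE ej; case: eqP => [[e]|]; last by rewrite mulr0.
    by rewrite e eqxx in ne_ba.
  by rewrite big1 // => b _; rewrite mxE ej mulr0.
pose f := linfun (mulmxr M : 'rV_k -> V).
have -> : flat x = (f @: fullv)%VS.
  apply/eqP; rewrite eqEsubv; apply/andP; split; apply/subvP => y.
    move=> /flat_param[z ->]; apply/memv_imgP; exists (\row_a z a).
      exact: memvf.
    rewrite lfunE /= MP; apply/rowP => j; rewrite !mxE.
    by case: (io j) => // a; rewrite mxE.
  by move=> /memv_imgP[v _ ->]; rewrite lfunE /= MP param_flat.
rewrite limg_dim_eq ?dimvf /dim /= ?mul1n //.
apply/eqP; rewrite -subv0; apply/subvP => v; rewrite memv_cap memv_ker lfunE /=.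
move=> /andP[_ /eqP v0]; rewrite memv0; apply/eqP/rowP => a; rewrite mxE.
have [j ej] := io_surj a; have := congr1 (fun w : V => w 0 j) v0.
rewrite MP !mxE ej => /eqP; rewrite mulf_eq0 sgr_eq0 (negPf (io_neq0 ej)).
by move/eqP.
Qed.

(** The signs of all forms are equivalent to the signs of the coordinates together with the order of
    their absolute values, by [sgr_sub_eq] and [same_sign_norm]. *)
Lemma param_same_sign z : same_sign (param z) x <->
  (forall a, 0 < z a) /\ (forall a b : 'I_k, (a < b)%N -> z a < z b).
Proof.
split=> [zx|[z_gt0 z_lt]].
  have z_gt0 a : 0 < z a.
    have [j ej] := io_surj a.
    have := same_signP _ _ zx (inl j); rewrite /= mxE ej.
    case: (ltrgt0P (x 0 j)) (io_neq0 ej) => // xj _.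
      by rewrite (gtr0_sg xj) mul1r => e; rewrite -sgr_gt0 e ltr01.
    rewrite (ltr0_sg xj) mulN1r sgrN => /oppr_inj e.
    by rewrite -sgr_gt0 e ltr01.
  split=> // a b lt_ab.
  have [i ei] := io_surj a; have [j ej] := io_surj b.
  move: lt_ab; rewrite (io_lt ei ej) -(same_sign_norm _ _ zx) !mxE ei ej.
  rewrite !normrM !normr_sg !(io_neq0 ei) !(io_neq0 ej) !mul1r.
  by rewrite !gtr0_norm.
have z_mono (a b : 'I_k) : (z a < z b) = (a < b)%N.
  case: (ltngtP a b) => [/z_lt //|/z_lt|/val_inj ->]; last exact: ltxx.
  exact: lt_gtF.
have sgP j : Num.sg (param z 0 j) = Num.sg (x 0 j).
  rewrite mxE; case ej: (io j) => [a|]; first by rewrite sgrM sgr_id (gtr0_sg (z_gt0 a)) mulr1.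
  by apply/esym/eqP; rewrite sgr0 sgr_eq0 -io0 ej.
have normP j : `|param z 0 j| = if io j is Some a then z a else 0.
  rewrite mxE; case ej: (io j) => [a|]; last by rewrite normr0.
  by rewrite normrM normr_sg (io_neq0 ej) mul1r gtr0_norm.
have ltP i j : (`|param z 0 i| < `|param z 0 j|) = (`|x 0 i| < `|x 0 j|).
  rewrite !normP; case ei: (io i) => [a|]; case ej: (io j) => [b|].
  - by rewrite z_mono (io_lt ei ej).
  - move/eqP: ej; rewrite io0 => /eqP ->; rewrite normr0 normr_lt0.
    by rewrite lt_gtF.
  - move/eqP: ei; rewrite io0 => /eqP ->; rewrite normr0 normr_gt0.
    by rewrite z_gt0 (io_neq0 ej).
  - by move/eqP: ei; move/eqP: ej; rewrite !io0 => /eqP -> /eqP ->; rewrite normr0.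
apply/same_signP => -[i|[[[i j] b] /= lt_ij]] /=; first exact: sgP.
apply: sgr_sub_eq; rewrite ?normrMsign ?sgP ?ltP //.
by rewrite !sgrM sgP.
Qed.

End Ranks.

(** * Lattice points *)

Section Box.
Variables (R : realType) (n m : nat).
Local Notation V := 'rV[R]_n.
Local Notation side := 'I_(2 * m).+1.

(** Shifts {0, ..., 2m} to {-m, ..., m}; [rev_ord] then becomes negation. *)
Definition centered (c : side) : R := c%:R - m%:R.

Definition box_point (p : {ffun 'I_n -> side}) : V := \row_j centered (p j).

Lemma centered_inj : injective centered.
Proof. by move=> c d /addIr /eqP; rewrite eqr_nat => /eqP /val_inj. Qed.

Lemma centered_rev c : centered (rev_ord c) = - centered c.
Proof.
rewrite /centered /= subSS natrB -1?ltnS ?ltn_ord // natrM; ring.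
Qed.

Lemma box_point_inj : injective box_point.
Proof.
move=> p q e; apply/ffunP => j; apply: centered_inj.
by have := congr1 (fun w : V => w 0 j) e; rewrite !mxE.
Qed.

Section Count.
Variables (x : V) (k : nat) (io : 'I_n -> option 'I_k).
Hypothesis io0 : forall j, (io j == None) = (x 0 j == 0).
Hypothesis io_lt : forall i j a b, io i = Some a -> io j = Some b ->
  (a < b)%N = (`|x 0 i| < `|x 0 j|).
Hypothesis io_surj : forall a, exists j, io j = Some a.

Let io_neq0 j a : io j = Some a -> x 0 j != 0.
Proof. by rewrite -io0 => ->. Qed.

(** The version of [param] on box indices: [rev_ord] changes the sign, and [inord m] stands for
    0. *)
Let e (q : {ffun 'I_k -> side}) : {ffun 'I_n -> side} :=
  [ffun j => if io j is Some a then if 0 < x 0 j then q a else rev_ord (q a)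
             else inord m].

Let e_point q : box_point (e q) = param x io (centered \o q).
Proof.
apply/rowP => j; rewrite !mxE ffunE; case ej: (io j) => [a|] /=.
  case: (ltrgt0P (x 0 j)) (io_neq0 ej) => // xj _.
    by rewrite gtr0_sg // mul1r.
  by rewrite ltr0_sg // centered_rev mulN1r.
by rewrite /centered inordK ?subrr //; lia.
Qed.

Let e_inj : injective e.
Proof.
move=> q q' eq; apply/ffunP => a; have [j ej] := io_surj a.
have := congr1 (fun p : {ffun _ -> _} => p j) eq; rewrite !ffunE ej.
by case: ifP => // _ /rev_ord_inj.
Qed.

(** The parameters of a box point on the flat are, up to sign, some of its coordinates, so they stay
    in the box. *)
Let e_surj p : box_point p \in flat x -> exists q, p = e q.
Proof.
move=> /(flat_param io0 io_lt io_surj)[z pz]; have [s sP] := choice io_surj.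
exists [ffun a => if 0 < x 0 (s a) then p (s a) else rev_ord (p (s a))].
apply: box_point_inj; rewrite e_point pz; apply/rowP => j; rewrite !mxE.
case ej: (io j) => [a|//]; congr (_ * _); rewrite /= ffunE.
have := congr1 (fun w : V => w 0 (s a)) pz; rewrite !mxE sP.
case: (ltrgt0P (x 0 (s a))) (io_neq0 (sP a)) => // xj _.
  by rewrite gtr0_sg // mul1r.
by rewrite ltr0_sg // mulN1r centered_rev => ->; rewrite opprK.
Qed.

Lemma card_box_flat_rank :
  #|[set p | box_point p \in flat x]| = ((2 * m).+1 ^ k)%N.
Proof.
have -> : [set p | box_point p \in flat x] = e @: [set: {ffun 'I_k -> side}].
  apply/setP => p; rewrite inE; apply/idP/imsetP => [/e_surj[q ->]|[q _ ->]].
    by exists q.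
  by rewrite e_point param_flat.
by rewrite card_imset // cardsT card_ffun !card_ord.
Qed.

(** The parameters form a chain 0 < z_0 < ... < z_(k-1) <= m of integers, that is, a k-subset of {1,
    ..., m}. *)
Lemma card_box_cone_rank :
  #|[set p | same_sign (box_point p) x]| = 'C(m, k).
Proof.
(* An entry c of the tuple, with 0 <= c < m, stands for the absolute value c + 1, whose index in
   [side] is m + 1 + c. *)
pose f (t : k.-tuple 'I_m) := e [ffun a => inord (m.+1 + tnth t a)].
have inordE (c : 'I_m) : (inord (m.+1 + c) : side) = (m.+1 + c)%N :> nat.
  by rewrite inordK //; have := ltn_ord c; lia.
have f_inj : injective f.
  move=> t t' /e_inj /ffunP eq; apply: eq_from_tnth => a.
  have := congr1 val (eq a); rewrite !ffunE /= !inordE => /addnI.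
  exact: val_inj.
have tupleE (t : k.-tuple 'I_m) (a : 'I_k) :
    nth 0%N [seq val i | i <- t] a = tnth t a.
  have d := tnth t a.
  by rewrite (nth_map d) ?size_tuple // (tnth_nth d).
rewrite -card_ltn_sorted_tuples -(card_imset _ f_inj); congr #|pred_of_set _|.
apply/setP => p; rewrite inE; apply/idP/imsetP => [px|[t + ->]].
  have [q ep] : exists q, p = e q.
    by apply/e_surj/same_sign_flat; rewrite same_sign_sym.
  move: px; rewrite ep e_point => /(param_same_sign io0 io_lt io_surj)[q_gt0 q_lt].
  have q_gt a : (m < q a)%N.
    by have := q_gt0 a; rewrite /= /centered subr_gt0 ltr_nat.
  have q_bound a : (q a - m.+1 < m)%N.
    by have := q_gt a; have := ltn_ord (q a); lia.
  exists [tuple Ordinal (q_bound a) | a < k].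
    rewrite inE; apply/(sortedP 0%N) => i; rewrite size_map size_tuple => lt_ik.
    rewrite (tupleE _ (Ordinal lt_ik)) (tupleE _ (Ordinal (ltnW lt_ik))).
    rewrite !tnth_mktuple /=.
    have := q_lt (Ordinal (ltnW lt_ik)) (Ordinal lt_ik) (ltnSn i).
    rewrite /= /centered ltrD2r ltr_nat.
    by have := q_gt (Ordinal (ltnW lt_ik)); lia.
  congr e; apply/ffunP => a; apply/val_inj; rewrite ffunE /= inordE tnth_mktuple /=.
  by have := q_gt a; lia.
rewrite inE => t_sorted; rewrite e_point; apply/(param_same_sign io0 io_lt io_surj).
split=> [a|a b lt_ab]; rewrite /= !ffunE /centered !inordE.
  by rewrite subr_gt0 ltr_nat; lia.
rewrite ltrD2r ltr_nat ltn_add2l -!tupleE.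
by apply: (sorted_ltn_nth ltn_trans 0%N t_sorted) => //; rewrite inE size_map size_tuple.
Qed.

End Count.

Lemma card_box_flat x :
  #|[set p | box_point p \in flat x]| = ((2 * m).+1 ^ \dim (flat x))%N.
Proof.
have [k [io [io0 io_lt io_surj]]] := exists_abs_ranks x.
by rewrite (dim_flat io0 io_lt io_surj) (card_box_flat_rank io0 io_lt io_surj).
Qed.

Lemma card_box_cone x :
  #|[set p | same_sign (box_point p) x]| = 'C(m, \dim (flat x)).
Proof.
have [k [io [io0 io_lt io_surj]]] := exists_abs_ranks x.
by rewrite (dim_flat io0 io_lt io_surj) (card_box_cone_rank io0 io_lt io_surj).
Qed.

End Box.

(** * Both sides count the box points on the union *)

Section Main.
Variables (R : realType) (n : nat) (A : {fset {vspace 'rV[R]_n}}).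
Hypotheses (properA : fullv \notin A) (embA : embedded_in_B A).
Local Notation V := 'rV[R]_n.

Definition in_union (x : V) :=
  has (fun U : {vspace V} => x \in U) (enum_fset A).

Lemma mem_arr_closed U : U \in A -> B_closed U.
Proof.
move=> UA; apply: (B_closed_embedded embA); apply/mem_inter_latticeP.
exists [fset U]%fset; last by rewrite big_seq_fset1.
by move=> W; rewrite inE => /eqP ->.
Qed.

Lemma tail_poly_count m :
  (tail_poly A).[(2 * m + 1)%:R]
  = #|[set p | in_union (box_point R (n := n) (m := m) p)]|%:R.
Proof.
rewrite /tail_poly /char_poly_arr hornerD hornerN hornerXn horner_sum.
(* Replace (2m+1)^(dim Y) by a sum over the box points on Y, so that the two sums can be exchanged
   and Möbius inversion applied at each point. *)
rewrite big_seq (eq_bigr (fun Y => \sum_p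
    mobius (inter_lattice A) (@rev_incl _ V) fullv Y
    * (box_point R (n := n) (m := m) p \in Y)%:R)); last first.
  move=> Y YL; rewrite hornerZ hornerXn -mulr_sumr; congr (_ * _).
  have [x _ ->] := B_closed_flat (B_closed_embedded embA YL).
  rewrite -natr_sum -natrX addn1 -card_box_flat -sum1_card big_mkcond /=.
  by congr (_%:R); apply: eq_bigr => p _; rewrite inE; case: ifP.
rewrite -big_seq exchange_big /=.
rewrite (eq_bigr (fun p => (~~ in_union (box_point R (n := n) (m := m) p))%:R)); last first.
  move=> p _; rewrite -(mobius_point _ properA) [RHS]big_mkcond.
  by apply: eq_bigr => Y _; case: ifP; rewrite ?mulr1 ?mulr0.
(* The leading term counts the whole box, so the difference counts the points on the union. *)
have -> : ((2 * m + 1)%:R ^+ n : int) = \sum_(p : {ffun 'I_n -> 'I_(2 * m).+1}) 1.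
  by rewrite sumr_const card_ffun !card_ord -natrX addn1.
rewrite -sumrB -sum1_card natr_sum [RHS]big_mkcond /=.
by apply: eq_bigr => p _; rewrite inE; case: (in_union _); rewrite ?subr0 ?subrr.
Qed.

Lemma B_closed_same_sign U (x y : V) :
  B_closed U -> same_sign x y -> x \in U -> y \in U.
Proof.
move=> Ucl xy xU; apply: Ucl => h Uh; apply/eqP.
move/same_signP: xy => xy; rewrite -sgr_eq0 -xy sgr_eq0.
by rewrite -mem_B_hyperplane (subvP Uh).
Qed.

Hypothesis A_neq0 : A != fset0.

(** Members of [A] are unions of open cones, so one point decides for its whole cell. The empty face
    is always present, and matches the origin, which lies on the union as [A] is nonempty. *)
Lemma sub_complex_cell (x : V) : (cell_of x \in sub_complex A) = in_union x.
Proof.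
rewrite !inE /= cell_of_B /=; apply/asboolP/hasP => [xA|[U UA xU] y [_ yx]].
  have [->|/cell_of_neq0[c c0 /xA[U UA cxU]]] := eqVneq x 0.
    by have /fset0Pn[U UA] := A_neq0; exists U; rewrite ?mem0v.
  exists U => //; move/(memvZ c^-1): cxU.
  by rewrite scalerA mulVf ?scale1r // gt_eqF.
exists U => //; rewrite same_sign_sym in yx.
exact: B_closed_same_sign (mem_arr_closed UA) yx xU.
Qed.

Lemma sub_complexP F : F \in sub_complex A -> exists2 x, F = cell_of x & in_union x.
Proof.
move=> FA; have : F \in B_complex R n by move: FA; rewrite !inE => /andP[].
case/imfsetP => s _ Fs; have [x sx] := B_cellE R s.
exists x; first by rewrite Fs sx.
by rewrite -sub_complex_cell -sx -Fs.
Qed.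

(** If x lies in U, then so does its flat, which bounds the rank of its cell by dim U. Equality
    holds at a generic point of U. *)
Lemma complex_rank_arr : complex_rank (sub_complex A) = arr_dim A.
Proof.
apply/eqP; rewrite eqn_leq; apply/andP; split.
  apply/bigmax_leqP_seq => F /sub_complexP[x -> /hasP[U UA xU]] _.
  rewrite face_rank_cell /arr_dim (big_rem U UA) /= leq_max dimvS //.
  apply/subvP => y /mem_flatP yx; apply: (mem_arr_closed UA) => h Uh.
  by apply: yx; apply/eqP; rewrite -mem_B_hyperplane (subvP Uh).
apply/bigmax_leqP_seq => U UA _.
have [x xU eU] := B_closed_flat (mem_arr_closed UA).
have FA : cell_of x \in sub_complex A.
  by rewrite sub_complex_cell; apply/hasP; exists U.
rewrite /complex_rank (big_rem (cell_of x) FA) /= leq_max.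
by rewrite face_rank_cell -eU leqnn.
Qed.

(** Each box point on the union lies in the open cone of exactly one face, and [card_box_cone]
    counts the points in each cone. *)
Lemma sub_complex_count m :
  (\sum_(F <- sub_complex A) 'C(m, face_rank F))%N
  = #|[set p | in_union (box_point R (n := n) (m := m) p)]|.
Proof.
rewrite -sum1_card.
rewrite (eq_bigl (fun p => (cell_of (box_point R p) \in sub_complex A))); last first.
  by move=> p; rewrite inE sub_complex_cell.
transitivity (\sum_(F <- sub_complex A)
    \sum_(p : {ffun 'I_n -> 'I_(2 * m).+1} | cell_of (box_point R p) == F) 1)%N.
  rewrite big_seq [RHS]big_seq; apply: eq_bigr => F /sub_complexP[x -> _].
  rewrite face_rank_cell -card_box_cone -sum1_card; apply: eq_bigl => p.
  by rewrite inE; apply/idP/eqP => [/cell_of_eq|/cell_of_eq].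
rewrite (exchange_big_dep predT) //= [RHS]big_mkcond /=; apply: eq_bigr => p _.
rewrite sum1_count; under eq_count => F do rewrite eq_sym.
by rewrite count_uniq_mem ?fset_uniq //; case: (_ \in _).
Qed.

End Main.

(* [A] consists of proper subspaces, as usual for subspace arrangements: for
   [A] = {R^n} the tail is 0 whereas the left-hand side is not. *)
Theorem theorem5p6 (R : realType) (n : nat) (A : {fset {vspace 'rV[R]_n}})
    (properA : fullv \notin A) (embA : embedded_in_B A) :
  forall m : nat,
    fps_div (fps_of_poly (hbar_arr A))
            (fps_of_poly ((1 - 'X) ^+ (arr_dim A).+1)) m
    = (tail_poly A).[(2 * m + 1)%:R].
Proof.
move=> m; rewrite tail_poly_count // /hbar_arr.
have [A0|A_neq0] := eqVneq A fset0; last first.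
  rewrite -(complex_rank_arr embA A_neq0) hbar_poly_series.
  by rewrite (sub_complex_count embA A_neq0).
(* For empty [A], [hbar_arr] is 0 by convention and the union has no points. *)
rewrite /fps_div /fps_mul big1 => [|i _]; last by rewrite /fps_of_poly coef0 mul0r.
rewrite (_ : [set p | _] = finset.set0) ?cards0 //.
by apply/setP => p; rewrite !inE /in_union A0.
Qed.
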